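(* For any positive integer $m\ge 3$, $$\max\{\gamma(K): K\text{ is a polyhedral cone with } m \text{ extreme rays}\}=m^2-2m+2,$$ where the maximum is taken over polyhedral cones of all possible dimensions.
   Context: A proper cone is a closed, pointed ($K\cap(-K)=\{0\}$) convex cone with nonempty interior. A polyhedral cone is a proper cone (in its linear span) with finitely many extreme rays. $\pi(K)$ is the set of real matrices (linear maps on the span of $K$) $A$ with $AK\subseteq K$. $A\in\pi(K)$ is $K$-primitive if $A^p(K\setminus\{0\})\subseteq\operatorname{int}K$ for some positive integer $p$; the least such $p$ is the exponent $\gamma(A)$. For polyhedral $K$, $\gamma(K)=\max\{\gamma(A):A\text{ is }K\text{-primitive}\}$. *)

(* Defs.v *)
From HB Require Import structures.
From mathcomp Require Import all_boot all_order all_algebra.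
From mathcomp Require Import all_classical all_reals all_analysis.

Set Implicit Arguments.
Unset Strict Implicit.
Unset Printing Implicit Defensive.

Import Order.TTheory GRing.Theory Num.Theory.
Import numFieldNormedType.Exports.

Local Open Scope classical_set_scope.
Local Open Scope ring_scope.

Definition is_min (S : set nat) (g : nat) : Prop :=
  S g /\ forall k, S k -> (g <= k)%N.

Definition is_max (S : set nat) (g : nat) : Prop :=
  S g /\ forall k, S k -> (k <= g)%N.

Section Cones.
Variables (R : realType) (n : nat).
Implicit Types (K : set 'cV[R]_n) (x : 'cV[R]_n) (A : 'M[R]_n).

Definition convex_cone K : Prop :=
  [/\ K 0,
      forall x y, K x -> K y -> K (x + y) &
      forall (a : R) x, 0 <= a -> K x -> K (a *: x)].

Definition pointed K : Prop := K `&` [set x | K (- x)] = [set 0].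

Definition lin_span K : set 'cV[R]_n :=
  [set x | exists (k : nat) (c : 'I_k -> R) (v : 'I_k -> 'cV[R]_n),
    (forall i, K (v i)) /\ x = \sum_(i < k) c i *: v i].

(* Cones are viewed inside their linear span, so the interior is taken in the
   subspace topology of [lin_span K]; it is the usual interior when K spans
   the whole space. *)
Definition span_interior K : set 'cV[R]_n :=
  [set x | lin_span K x /\ within (lin_span K) (nbhs x) K].

Definition proper_cone K : Prop :=
  [/\ closed K, pointed K, convex_cone K & span_interior K !=set0].

Definition ray x : set 'cV[R]_n := [set y | exists2 a : R, 0 <= a & y = a *: x].

Definition extreme_vector K x : Prop :=
  [/\ K x, x != 0 & forall y, K y -> K (x - y) -> ray x y].

Definition extreme_rays K : set (set 'cV[R]_n) :=
  [set r | exists2 x, extreme_vector K x & r = ray x].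

Definition polyhedral_cone K : Prop :=
  proper_cone K /\ finite_set (extreme_rays K).

(* When K does not span the whole space, a matrix stands for its restriction
   to [lin_span K]: every linear map of the span preserving K extends to such a
   matrix, and primitivity and the exponent only depend on the restriction. *)
Definition cone_preserving K A : Prop := forall x, K x -> K (A *m x).

Definition primitive_powers K A : set nat :=
  [set p | (0 < p)%N /\
    forall x, K x -> x != 0 -> span_interior K ((A ^+ p) *m x)].

Definition K_primitive K A : Prop :=
  cone_preserving K A /\ primitive_powers K A !=set0.

Definition matrix_exponent K A (g : nat) : Prop :=
  is_min (primitive_powers K A) g.

Definition cone_exponent K (g : nat) : Prop :=
  is_max [set p | exists2 A, K_primitive K A & matrix_exponent K A p] g.

End Cones.

(* Main.v *)
(* For a cone [K] with extreme vectors [e_1, .., e_m], record a vector [y] of [K]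
   by the set of indices [j] such that [e_j <= c y] in the cone order for some
   [c >= 0].  A matrix [A] preserving [K] induces a monotone map [N] on sets of
   indices, and [A^p x] is interior exactly when its index set is full.
   If [j] lies in [N^l {j}], the sets [N^(k l) {j}] increase with [k], strictly
   until they are full, so [N^(l (m-1)) {j}] is full.  Following successors from
   [i], a closed walk of length [l] is reached after [t] steps with [t + l <= m].
   One can take [l <= m - 1], for if all choices of successors gave [l = m] then
   [A] would permute the extreme rays; hence [t + l (m-1) <= (m-1)^2 + 1].
   Equality holds for the nonnegative orthant and Wielandt's matrix, whose graph
   is an [m]-cycle with one chord. *)
Require Import Defs.
From mathcomp Require Import all_boot all_order all_algebra zify lra.
From mathcomp Require Import all_classical all_reals all_analysis.

Set Implicit Arguments.
Unset Strict Implicit.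
Unset Printing Implicit Defensive.

Import Order.TTheory GRing.Theory Num.Theory.
Import numFieldNormedType.Exports.

(** * Monotone operators on finite sets *)

Section MonotoneSetOperator.
Variables (T : finType) (N : {set T} -> {set T}).
Hypothesis N_mono : forall S U : {set T}, S \subset U -> N S \subset N U.

Lemma iter_mono k (S U : {set T}) :
  S \subset U -> iter k N S \subset iter k N U.
Proof. by move=> sSU; elim: k => //= k; exact: N_mono. Qed.

Lemma iter_walk i j l k :
  j \in iter l N [set i] -> iter k N [set j] \subset iter (l + k) N [set i].
Proof. by move=> jl; rewrite addnC iterD; apply: iter_mono; rewrite finset.sub1set. Qed.

Hypothesis NT : N finset.setT = finset.setT.

Lemma iter_full k l (S : {set T}) :
  iter k N S = finset.setT -> k <= l -> iter l N S = finset.setT.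
Proof.
by move=> kT /subnK <-; rewrite iterD kT; elim: (l - k) => //= n ->.
Qed.

Hypothesis N_prim : forall i, exists p, iter p N [set i] = finset.setT.

(* Along a closed walk the iterated images of a vertex increase; if they stall
   before reaching [setT] they stall forever. *)
Lemma closed_walk_full j l : 0 < l -> j \in iter l N [set j] ->
  iter (#|T|.-1 * l) N [set j] = finset.setT.
Proof.
move=> l0 jl; set F := fun k => iter (k * l) N [set j].
have Finc k : F k \subset F k.+1.
  by rewrite /F mulSn; exact: iter_walk.
have FS k : F k.+1 = iter l N (F k) by rewrite /F mulSn iterD.
have grow k : F k = finset.setT \/ k < #|F k|.
  elim: k => [|k [IH|IH]]; first by right; rewrite /F mul0n /= cards1.
    by left; apply/eqP; rewrite -finset.subTset -IH Finc.
  have [e|ne] := eqVneq (F k) (F k.+1); last first.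
    right; apply: leq_ltn_trans IH _; apply: proper_card.
    by rewrite finset.properEneq ne Finc.
  have stall d : F (d + k) = F k.
    by elim: d => // d IHd; rewrite addSn FS IHd -FS -e.
  have [p pT] := N_prim j.
  left; rewrite -e -(stall p); apply: (iter_full pT).
  by rewrite mulnDl (leq_trans _ (leq_addr _ _)) // leq_pmulr.
case: (grow #|T|.-1) => // h; apply/eqP; rewrite eqEcard finset.subsetT cardsT.
by move: h; rewrite /F; case: #|T|.
Qed.

(** A closed walk of length [l] entered after [t] steps fills everything by time
    [t + (#|T| - 1) * l]. Written as [(t + l) + (#|T| - 2) * l], this is at most the stated bound
    because [l <= #|T| - 1]. *)
Lemma lollipop_full i j t l : 0 < l < #|T| -> t + l <= #|T| ->
  j \in iter t N [set i] -> j \in iter l N [set j] ->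
  iter (#|T| ^ 2 - 2 * #|T| + 2) N [set i] = finset.setT.
Proof.
move=> /andP[l0 lT] tl jt jl.
apply: (@iter_full (t + #|T|.-1 * l)); last by nia.
apply/eqP; rewrite -finset.subTset -(closed_walk_full l0 jl); exact: iter_walk.
Qed.

Hypothesis N0 : N finset.set0 = finset.set0.
Hypothesis T_gt1 : 1 < #|T|.

Lemma monotone_wielandt i :
  iter (#|T| ^ 2 - 2 * #|T| + 2) N [set i] = finset.setT.
Proof.
(* An empty image of a singleton would stay empty under [N], against [N_prim]; hence a successor
   function [f] can be chosen. *)
have Nn0 j : exists k, k \in N [set j].
  apply/finset.set0Pn/eqP => Nj0; have [[|p] pT] := N_prim j.
    by move: T_gt1; rewrite -cardsT -pT cards1.
  move: pT; rewrite iterSr Nj0 => pT.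
  have : iter p N finset.set0 = finset.set0 by elim: (p) => //= q ->.
  by rewrite pT => T0; move: T_gt1; rewrite -cardsT T0 cards0.
pose f j := xchoose (Nn0 j).
have fN j : f j \in N [set j] by exact: xchooseP.
have fwalk k j : iter k f j \in iter k N [set j].
  elim: k => [|k IH]; first by rewrite inE.
  by have /fintype.subsetP := iter_walk 1 IH; rewrite addn1; apply; exact: fN.
have ordT : order f i <= #|T| by exact: max_card.
(* The orbit of [i] under [f] is a tail of length [t] followed by a cycle of length
   [order f i - t]. *)
have /trajectP[t tlt et] := looping_order f i.
have tcycle : iter t f i \in iter (order f i - t) N [set iter t f i].
  by rewrite -{1}et -{1}(subnK (ltnW tlt)) iterD.
have [lT|] := ltnP (order f i - t) #|T|.
  by apply: (@lollipop_full i (iter t f i) t (order f i - t)) => //; lia.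
(* Otherwise [f] is a single cycle through all of [T], and a chord is needed to shorten it. *)
move=> Tl; have t0 : t = 0 by lia.
have oT : order f i = #|T| by lia.
rewrite t0 oT /= in et.
have onto x : exists2 k, k < #|T| & x = iter k f i.
  have fx : fconnect f i x.
    have /subset_cardP/(_ (subset_predT _))/(_ x) : #|fconnect f i| = #|T| by [].
    by rewrite !inE.
  by exists (findex f i x); rewrite ?iter_findex // -oT findex_max.
(* If [f v] were always the only successor of [v], the iterates of [[set i]] would stay singletons
   and never fill [T]. *)
have [chord|nochord] := boolP [exists v, exists w, (w \in N [set v]) && (w != f v)];
    last first.
  have Nf v : N [set v] = [set f v].
    apply/finset.setP => w; rewrite inE; apply/idP/eqP => [wN|->//].
    apply/eqP/negPn/negP => wf; move/negP: nochord; apply.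
    by apply/existsP; exists v; apply/existsP; exists w; rewrite wN wf.
  have [p pT] := N_prim i.
  have ip q : iter q N [set i] = [set iter q f i] by elim: q => //= q ->.
  by move: T_gt1; rewrite -cardsT -pT ip cards1.
have /existsP[v /existsP[w /andP[wN wf]]] := chord.
have [[a aT ea] [b bT eb]] := (onto v, onto w).
have vw : w \in iter 1 N [set v] by [].
(* A backward chord from position [a] to position [b] closes a walk of length [a - b + 1]. Length
   [#|T|] would force [b = 0] and [a = #|T| - 1], where [w = f v]. *)
have [ba|ab] := leqP b a.
  apply: (@lollipop_full i w b (a - b).+1); [|by lia| |].
  - rewrite ltnS leq0n andTb ltn_neqAle; apply/andP; split; last by lia.
    apply/eqP => abT; have [b0 aT1] : b = 0 /\ a.+1 = #|T|.
      by lia.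
    by move/eqP: wf; apply; rewrite ea -iterS aT1 et eb b0.
  - by rewrite eb.
  - have vab : v \in iter (a - b) N [set w].
      by rewrite ea -{1}(subnK ba) iterD -eb.
    by have /fintype.subsetP := iter_walk 1 vab; rewrite addn1; apply.
(* A forward chord shortcuts the cycle at [i]; the new length equals [#|T|] only if [b = a + 1],
   where again [w = f v]. *)
apply: (@lollipop_full i i 0 (a + (1 + (#|T| - b)))); [| |by rewrite inE|].
- rewrite addnS ltnS leq0n andTb ltn_neqAle; apply/andP; split; last by lia.
  apply/eqP => abT; have ba1 : b = a.+1 by lia.
  by move/eqP: wf; apply; rewrite eb ba1 /= -ea.
- by lia.
have vi : v \in iter a N [set i] by rewrite ea.
apply: (fintype.subsetP (iter_walk _ vi)); apply: (fintype.subsetP (iter_walk _ vw)).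
by rewrite -[i in X in X \in _]et -{1}(subnK (ltnW bT)) iterD -eb.
Qed.

End MonotoneSetOperator.

Local Open Scope classical_set_scope.
Local Open Scope ring_scope.

(** * Convex cones and their extreme vectors *)

Lemma cV_neq0 (R : realType) n (x : 'cV[R]_n) : x != 0 -> exists i, x i 0 != 0.
Proof.
move=> x0; apply: contrapT => h; move/eqP: x0; apply; apply/colP => i.
by rewrite mxE; apply/eqP/negPn/negP => xi; apply: h; exists i.
Qed.

Lemma rayZ (R : realType) n (a : R) (x : 'cV[R]_n) : 0 < a -> ray (a *: x) = ray x.
Proof.
move=> a0; apply/seteqP; split=> y [b b0 ->].
  by exists (b * a); rewrite ?scalerA // mulr_ge0 // ltW.
exists (b / a); first by rewrite divr_ge0 // ltW.
by rewrite scalerA -mulrA mulVf ?mulr1 // gt_eqF.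
Qed.

Lemma is_min_exists (S : set nat) : S !=set0 -> exists g, is_min S g.
Proof.
move=> [p Sp]; have exS : exists k, `[< S k >] by exists p; exact/asboolP.
case: (ex_minnP exS) => g /asboolP Sg gmin; exists g; split => // k Sk.
by apply: gmin; exact/asboolP.
Qed.

Lemma is_max_exists (S : set nat) M :
  S !=set0 -> (forall k, S k -> (k <= M)%N) -> exists g, is_max S g.
Proof.
move=> [p Sp] SM; have exS : exists k, `[< S k >] by exists p; exact/asboolP.
have ubS k : `[< S k >] -> (k <= M)%N by move=> /asboolP/SM.
case: (ex_maxnP exS ubS) => g /asboolP Sg gmax; exists g; split => // k Sk.
by apply: gmax; exact/asboolP.
Qed.

(** The cone order up to scaling: for [x] and [y] in a convex cone, [x] lies in the smallest face
    containing [y]. *)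
Definition dominated (R : realType) n (K : set 'cV[R]_n) (x y : 'cV[R]_n) : Prop :=
  exists2 c : R, 0 <= c & K (c *: y - x).

Section ConvexCone.
Variables (R : realType) (n : nat) (K : set 'cV[R]_n).
Hypothesis coneK : convex_cone K.
Implicit Types x y z d : 'cV[R]_n.

Lemma cone0 : K 0. Proof. by case: coneK. Qed.

Lemma coneD x y : K x -> K y -> K (x + y).
Proof. by case: coneK => _ h _; exact: h. Qed.

Lemma coneZ (a : R) x : 0 <= a -> K x -> K (a *: x).
Proof. by case: coneK => _ _; exact. Qed.

Lemma cone_sum (I : Type) (r : seq I) (P : pred I) (F : I -> 'cV[R]_n) :
  (forall i, P i -> K (F i)) -> K (\sum_(i <- r | P i) F i).
Proof. by move=> KF; elim/big_ind: _ => //; [exact: cone0 | exact: coneD]. Qed.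

Lemma dominated_refl x : dominated K x x.
Proof. by exists 1; rewrite ?scale1r ?subrr //; exact: cone0. Qed.

Lemma dominatedB x y : K (y - x) -> dominated K x y.
Proof. by exists 1; rewrite ?scale1r. Qed.

Lemma dominatedN x y : K x -> dominated K (- x) y.
Proof. by exists 0; rewrite ?scale0r ?opprK ?add0r. Qed.

Lemma dominated_trans y x z : dominated K x y -> dominated K y z -> dominated K x z.
Proof.
move=> [c c0 Kc] [d d0 Kd]; exists (c * d); first exact: mulr_ge0.
have -> : (c * d) *: z - x = c *: (d *: z - y) + (c *: y - x).
  by rewrite scalerBr scalerA addrA subrK.
by apply: coneD => //; exact: coneZ.
Qed.

Lemma dominatedD x y z : dominated K x z -> dominated K y z -> dominated K (x + y) z.
Proof.
move=> [c c0 Kc] [d d0 Kd]; exists (c + d); first exact: addr_ge0.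
by rewrite scalerDl opprD addrACA; exact: coneD.
Qed.

Lemma dominated0 z : dominated K 0 z.
Proof. by exists 0; rewrite // scale0r subrr; exact: cone0. Qed.

Lemma dominated_sum (I : Type) (r : seq I) (P : pred I) (F : I -> 'cV[R]_n) z :
  (forall i, P i -> dominated K (F i) z) -> dominated K (\sum_(i <- r | P i) F i) z.
Proof.
by move=> KF; elim/big_ind: _ => // [|x y]; [exact: dominated0 | exact: dominatedD].
Qed.

Lemma dominatedZ (a : R) x z : 0 <= a -> dominated K x z -> dominated K (a *: x) z.
Proof.
move=> a0 [c c0 Kc]; exists (a * c); first exact: mulr_ge0.
by rewrite -scalerA -scalerBr; exact: coneZ.
Qed.

Lemma dominated_mulmx (A : 'M[R]_n) x y :
  cone_preserving K A -> dominated K x y -> dominated K (A *m x) (A *m y).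
Proof.
by move=> KA [c c0 Kc]; exists c => //; rewrite scalemxAr -mulmxBr; exact: KA.
Qed.

Lemma extreme_vectorZ (a : R) x :
  0 < a -> extreme_vector K x -> extreme_vector K (a *: x).
Proof.
move=> a0 [Kx x0 ex]; split.
- by apply: coneZ => //; exact: ltW.
- by rewrite scaler_eq0 negb_or gt_eqF.
have a'0 : 0 <= a^-1 by rewrite invr_ge0 ltW.
move=> y Ky Kxy; have [] := ex (a^-1 *: y).
- exact: coneZ.
- have -> : x - a^-1 *: y = a^-1 *: (a *: x - y).
    by rewrite scalerBr scalerA mulVf ?scale1r // gt_eqF.
  exact: coneZ.
move=> b b0 e; exists b => //.
by rewrite scalerA mulrC -scalerA -e scalerA divff ?scale1r // gt_eqF.
Qed.

(** For [y] in the cone, these [d] form the linear span of the smallest face containing [y]. *)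
Definition lineality y d := dominated K d y /\ dominated K (- d) y.

Lemma lineality_span y (X : seq 'cV[R]_n) d :
  {in X, forall x, lineality y x} -> d \in <<X>>%VS -> lineality y d.
Proof.
move=> LX /(@coord_span _ _ _ (in_tuple X)) ->.
have LZ (a : R) x : lineality y x -> lineality y (a *: x).
  move=> [xy nxy]; have [a0|a0] := leP 0 a.
    by split; rewrite -?scalerN; exact: dominatedZ.
  have na0 : 0 <= - a by lra.
  split; first by rewrite -[a]opprK scaleNr -scalerN; exact: dominatedZ.
  by rewrite -scaleNr; exact: dominatedZ.
have LX_ i : lineality y (coord (in_tuple X) i d *: (in_tuple X)`_i).
  by apply: LZ; apply: LX; rewrite mem_nth.
split; first by apply: dominated_sum => i _; case: (LX_ i).
by rewrite -sumrN; apply: dominated_sum => i _; case: (LX_ i).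
Qed.

Lemma lineality_trans x y d : dominated K x y -> lineality x d -> lineality y d.
Proof. by move=> xy [dx ndx]; split; apply: dominated_trans xy. Qed.

Definition lineality_dim_le y k :=
  forall X : seq 'cV[R]_n, free X -> {in X, forall d, lineality y d} -> (size X <= k)%N.

(** The direction [d] is independent of every free family attached to [x], so adding it gives a
    longer free family attached to [y]. *)
Lemma lineality_dim_ltS x y d k : dominated K x y -> lineality y d ->
  ~ dominated K d x -> lineality_dim_le y k.+1 -> lineality_dim_le x k.
Proof.
move=> xy yd xd yk X fX LX; rewrite -ltnS; apply: (yk (d :: X)).
  rewrite free_cons fX andbT; apply/negP => /(lineality_span LX) [dx _].
  exact: xd.
by move=> z; rewrite inE => /predU1P[->//|zX]; apply: lineality_trans xy (LX z zX).
Qed.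

Lemma lineality_dim_le_size y : lineality_dim_le y n.
Proof.
move=> X; rewrite /free => /eqP <- _.
by rewrite (leq_trans (dimvS (subvf _))) // dimvf /dim /= muln1.
Qed.

Lemma cvg_harmonic_line x z : (fun k => x + harmonic k *: z) @ \oo --> x.
Proof.
rewrite -[X in _ --> X]addr0 -(scale0r z).
by apply: cvgD; [exact: cvg_cst | apply: cvgZr_tmp; exact: cvg_harmonic].
Qed.

(** * Closed pointed cones are generated by their extreme vectors *)

Hypothesis closedK : closed K.

Lemma cone_line_limit x z : (forall a : R, 0 < a -> K (x + a *: z)) -> K x.
Proof.
move=> Kx; apply: (closed_cvg _ closedK _ _ (@cvg_harmonic_line x z)).
by near=> k; apply: Kx; rewrite invr_gt0 ltr0n.
Unshelve. all: by end_near. Qed.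

Hypothesis pointedK : pointed K.

Lemma pointedN x : K x -> K (- x) -> x = 0.
Proof.
by move=> Kx Knx; have : (K `&` [set x | K (- x)]) x by []; rewrite pointedK.
Qed.

(** Take for [t] the supremum of the [s] with [y - s *: z] in [K]. If there were no bound,
    closedness would put [- z] in [K], against pointedness; closedness also makes the supremum
    attained. Domination of [z] with constant [c] would let [t] grow by [c^-1]. *)
Lemma maximal_subtraction y z : K y -> K z -> z != 0 ->
  exists t : R, [/\ 0 <= t, K (y - t *: z) & ~ dominated K z (y - t *: z)].
Proof.
move=> Ky Kz z0; pose S := [set t : R | K (y - t *: z)].
have S_down t s : S s -> t <= s -> S t.
  move=> Ss ts; rewrite /S /=.
  have -> : y - t *: z = (y - s *: z) + (s - t) *: z.
    by rewrite scalerBl addrA subrK.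
  by apply: coneD => //; apply: coneZ => //; rewrite subr_ge0.
have S0 : S 0 by rewrite /S /= scale0r subr0.
have [ubS|noub] := pselect (has_ubound S); last first.
  exfalso; move/eqP: z0; apply; apply: pointedN => //.
  apply: (@cone_line_limit _ y) => a a0.
  have Sa : S a^-1.
    apply: contrapT => nSa; apply: noub; exists a^-1 => s Ss.
    by rewrite leNgt; apply/negP => /ltW/(S_down _ _ Ss).
  have -> : - z + a *: y = a *: (y - a^-1 *: z).
    by rewrite scalerBr scalerA divff ?gt_eqF // scale1r addrC.
  by apply: coneZ => //; exact: ltW.
have hsS : has_sup S by split => //; exists 0.
exists (sup S); split; first exact: ub_le_sup.
- apply: (@cone_line_limit _ z) => a a0.
  have [s Ss /ltW sa] := sup_adherent a0 hsS.
  by have := S_down _ _ Ss sa; rewrite /S /= scalerBl opprB addrA addrAC.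
move=> [c]; rewrite le_eqVlt => /predU1P[<-|c0].
  by rewrite scale0r sub0r => /(pointedN Kz)/eqP; rewrite (negPf z0).
move=> Kc; have : S (sup S + c^-1).
  rewrite /S /=.
  have -> : y - (sup S + c^-1) *: z = c^-1 *: (c *: (y - sup S *: z) - z).
    by rewrite scalerBr scalerA mulVf ?gt_eqF // scale1r scalerDl opprD addrA.
  by apply: coneZ => //; rewrite invr_ge0 ltW.
move=> /(ub_le_sup ubS); have : 0 < c^-1 by rewrite invr_gt0.
lra.
Qed.

(** Coefficients are absorbed into the extreme vectors, whose positive multiples are again
    extreme. *)
Definition extreme_sum y := exists2 s : seq 'cV[R]_n,
  {in s, forall x, extreme_vector K x} & y = \sum_(x <- s) x.

Lemma extreme_sumD x y : extreme_sum x -> extreme_sum y -> extreme_sum (x + y).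
Proof.
move=> [s es ->] [t et ->]; exists (s ++ t); last by rewrite big_cat.
by move=> z; rewrite mem_cat => /orP[/es|/et].
Qed.

Lemma extreme_sum0 : extreme_sum 0.
Proof. by exists [::]; rewrite ?big_nil. Qed.

Lemma extreme_sumZ (a : R) x : 0 <= a -> extreme_sum x -> extreme_sum (a *: x).
Proof.
rewrite le_eqVlt => /predU1P[<- _|a0 [s es ->]].
  by rewrite scale0r; exact: extreme_sum0.
exists [seq a *: x | x <- s]; last by rewrite big_map scaler_sumr.
by move=> _ /mapP[z /es ez ->]; exact: extreme_vectorZ.
Qed.

(* If [y] is not extreme, pick [z] in [K] below [y] and off its ray.  The two
   boundary points [y' = y - t z] and [z' = z - s y'] of the planar cone spanned
   by [y] and [z] lie in smaller faces, and [y] is a combination of them. *)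
Lemma cone_extreme_sum y : K y -> extreme_sum y.
Proof.
(* Induction on a bound [k] for the dimension of the face of [y], with the ambient dimension as
   initial bound. *)
move=> Ky; have := @lineality_dim_le_size y; move: {-1}n (erefl n) => k _.
elim: k y Ky => [|k IH] y Ky Ly.
  have [->|y0] := eqVneq y 0; first exact: extreme_sum0.
  suff : (size [:: y] <= 0)%N by [].
  apply: Ly; first by rewrite seq1_free.
  move=> d; rewrite inE => /eqP ->.
  by split; [exact: dominated_refl | exact: dominatedN].
have [->|y0] := eqVneq y 0; first exact: extreme_sum0.
have [ey|ney] := pselect (extreme_vector K y).
  by exists [:: y]; rewrite ?big_seq1 // => x; rewrite inE => /eqP ->.
have [z [Kz Kyz rz]] : exists z, [/\ K z, K (y - z) & ~ ray y z].
  apply: contrapT => h; apply: ney; split => // z Kz Kyz.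
  by apply: contrapT => rz; apply: h; exists z.
have z0 : z != 0.
  by apply/eqP => z0; apply: rz; exists 0; rewrite // z0 scale0r.
have [t [t0 Ky' zy']] := maximal_subtraction Ky Kz z0.
set y' := y - t *: z in Ky' zy'.
have y'0 : y' != 0.
  apply/eqP => /eqP; rewrite subr_eq0 => /eqP ytz.
  have tn0 : t != 0 by apply/eqP => tt; move: y0; rewrite ytz tt scale0r eqxx.
  by apply: rz; exists t^-1; rewrite ?invr_ge0 // ytz scalerA mulVf // scale1r.
have [s [s0 Kz' y'z']] := maximal_subtraction Kz Ky' y'0.
set z' := z - s *: y' in Kz' y'z'.
have y'y : dominated K y' y.
  by apply: dominatedB; rewrite /y' opprB addrC subrK; exact: coneZ.
have zy : dominated K z y by exact: dominatedB.
have z'y : dominated K z' y.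
  apply: dominated_trans zy; apply: dominatedB.
  by rewrite /z' opprB addrC subrK; exact: coneZ.
have -> : y = y' + t *: (z' + s *: y') by rewrite subrK /y' subrK.
have Ey' : extreme_sum y'.
  apply: IH => //; apply: lineality_dim_ltS y'y _ zy' Ly.
  by split => //; exact: dominatedN.
have Ez' : extreme_sum z'.
  apply: IH => //; apply: lineality_dim_ltS z'y _ y'z' Ly.
  by split => //; exact: dominatedN.
apply: extreme_sumD => //; apply: extreme_sumZ => //.
by apply: extreme_sumD => //; exact: extreme_sumZ.
Qed.

End ConvexCone.

(** * Supports and the upper bound *)

Section GeneratedCone.
Variables (R : realType) (n m : nat) (K : set 'cV[R]_n) (e : 'I_m -> 'cV[R]_n).
Hypothesis coneK : convex_cone K.
Hypothesis Ke : forall j, K (e j).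
Hypothesis genK : forall x, K x ->
  exists2 c : 'I_m -> R, (forall j, 0 <= c j) & x = \sum_j c j *: e j.
Implicit Types (x y z : 'cV[R]_n) (S U : {set 'I_m}).

Lemma span_interior_cone y : span_interior K y -> K y.
Proof. by move=> [Ly] /nbhs_singleton; apply. Qed.

Lemma cone_lin_span y : K y -> lin_span K y.
Proof.
by move=> Ky; exists 1%N, (fun=> 1), (fun=> y); rewrite big_ord1 scale1r.
Qed.

(** The vectors [y - x / (k + 1)] stay in the span and tend to [y], so one of them lies in [K];
    multiply it by [k + 1]. *)
Lemma span_interior_dominates x y : span_interior K y -> K x -> dominated K x y.
Proof.
move=> iy Kx; have [_ wy] := iy; have Ky := span_interior_cone iy.
have /(_ _ wy)[k _ /(_ k (leqnn k))] := @cvg_harmonic_line R n y (- x).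
rewrite /= => /(_ _) h.
have : K (y + harmonic k *: - x).
  apply: h; exists 2%N, (fun i => if i == ord0 then 1 else - harmonic k).
  exists (fun i => if i == ord0 then y else x); split; first by move=> i; case: ifP.
  by rewrite big_ord_recl big_ord1 /= scale1r scalerN scaleNr.
move=> Kyx; exists k.+1%:R => //.
have -> : k.+1%:R *: y - x = k.+1%:R *: (y + harmonic k *: - x).
  by rewrite scalerDr scalerA mulfV ?pnatr_eq0 // scale1r.
exact: coneZ.
Qed.

Let P : 'M[R]_(n, m) := \matrix_(i, j) e j i 0.

Lemma sum_genE (c : 'cV[R]_m) : P *m c = \sum_j c j 0 *: e j.
Proof.
apply/colP => i; rewrite mxE summxE; apply: eq_bigr => j _.
by rewrite !mxE mulrC.
Qed.

(** A generalized inverse of [P]: it chooses coefficients on the generators linearly in the vector,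
    so that small vectors of the span get small coefficients. *)
Let G : 'M[R]_(m, n) := (pinvmx P^T)^T.

Lemma gen_pinvK (c : 'cV[R]_m) : P *m (G *m (P *m c)) = P *m c.
Proof.
apply: trmx_inj; rewrite !trmx_mul /G trmxK mulmxKpV //; exact: submxMl.
Qed.

Lemma lin_span_gen z : lin_span K z -> exists c, z = P *m c.
Proof.
move=> [k [a [v [Kv ->]]]].
have /choice[c vc] i : exists c, v i = P *m c.
  have [c _ ->] := genK (Kv i); exists (\col_j c j).
  by rewrite sum_genE; apply: eq_bigr => j _; rewrite mxE.
exists (\sum_i a i *: c i); rewrite mulmx_sumr; apply: eq_bigr => i _.
by rewrite -scalemxAr vc.
Qed.

(** A vector of the span near [y] is [y] plus a combination of the [e j] with small coefficients
    [c j]. If [b *: y] dominates each [e j], then [b |c_j| y + c_j e_j] lies in [K] whatever the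
    sign of [c_j], and a nonnegative multiple of [y] is left over. *)
Lemma dominates_span_interior y :
  K y -> (forall j, dominated K (e j) y) -> span_interior K y.
Proof.
move=> Ky ey; have Ly := cone_lin_span Ky; split => //.
have /choice[a aP] j : exists c : R, 0 <= c /\ K (c *: y - e j).
  by have [c] := ey j; exists c.
pose b := 1 + \sum_j a j.
have a0 : 0 <= \sum_j a j by apply: sumr_ge0 => j _; case: (aP j).
have b0 : 0 < b by rewrite /b; lra.
have Kb j : K (b *: y - e j).
  have [aj0 Kj] := aP j.
  have -> : b *: y - e j = (b - a j) *: y + (a j *: y - e j).
    by rewrite scalerBl addrA subrK.
  apply: coneD => //; apply: coneZ => //.
  rewrite /b (bigD1 j) //=.
  have : 0 <= \sum_(i | i != j) a i by apply: sumr_ge0 => i _; case: (aP i).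
  lra.
pose M := \sum_j \sum_i `|G j i|.
have M0 : 0 <= M by apply: sumr_ge0 => j _; apply: sumr_ge0.
(* The coefficients sum in absolute value to at most [M * r], and this radius keeps
   [b * M * r <= 1]. *)
pose r := (b * M + 1)^-1.
have bM0 : 0 <= b * M by apply: mulr_ge0 => //; exact: ltW.
have r0 : 0 < r by rewrite invr_gt0; lra.
apply/nbhs_ballP; exists r => // z [_ yz] Lz.
have [cz Ez] := lin_span_gen Lz; have [cy Ey] := lin_span_gen Ly.
pose c := G *m (z - y).
have Ec : z - y = \sum_j c j 0 *: e j.
  by rewrite -sum_genE /c Ez Ey -mulmxBr gen_pinvK.
have cM : \sum_j `|c j 0| <= M * r.
  rewrite /M mulr_suml; apply: ler_sum => j _.
  rewrite /c mxE mulr_suml (le_trans (ler_norm_sum _ _ _)) //.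
  apply: ler_sum => i _; rewrite normrM ler_wpM2l // !mxE distrC.
  by apply: ltW; exact: yz.
have -> : z = (1 - b * \sum_j `|c j 0|) *: y
              + \sum_j (`|c j 0| *: (b *: y) + c j 0 *: e j).
  rewrite big_split /= -Ec -scaler_suml scalerA [_ * b]mulrC addrA -scalerDl.
  by rewrite subrK scale1r addrC subrK.
apply: coneD => //; last first.
  apply: cone_sum => // j _; have [cj|cj] := leP 0 (c j 0).
    by apply: coneD => //; do ?apply: coneZ => //; exact: ltW.
  rewrite ltr0_norm // scaleNr -scalerN -scalerDr.
  have -> : c j 0 *: (- (b *: y) + e j) = (- c j 0) *: (b *: y - e j).
    by rewrite scaleNr -scalerN opprB addrC.
  by apply: coneZ => //; rewrite oppr_ge0 ltW.
apply: coneZ => //; rewrite subr_ge0 (le_trans (ler_wpM2l (ltW b0) cM)) //.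
by rewrite mulrA /r ler_pdivrMr; lra.
Qed.

Definition gen_support y : {set 'I_m} := [set j | `[< dominated K (e j) y >]]%SET.

Lemma gen_supportP y j : reflect (dominated K (e j) y) (j \in gen_support y).
Proof. by rewrite finset.inE; exact: asboolP. Qed.

Lemma gen_support_dominated x y :
  dominated K x y -> gen_support x \subset gen_support y.
Proof.
move=> xy; apply/fintype.subsetP => j /gen_supportP jx; apply/gen_supportP.
exact: dominated_trans xy.
Qed.

Lemma span_interiorE y : K y -> span_interior K y <-> gen_support y = [set: 'I_m]%SET.
Proof.
move=> Ky; split=> [iy|suppT]; first last.
  apply: dominates_span_interior => // j; apply/gen_supportP.
  by rewrite suppT finset.inE.
apply/finset.setP => j; rewrite finset.in_setT; apply/gen_supportP.
exact: span_interior_dominates.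
Qed.

Definition gen_sum S := \sum_(j in S) e j.

Lemma gen_support_sum (c : 'I_m -> R) j : (forall i, 0 <= c i) -> 0 < c j ->
  j \in gen_support (\sum_i c i *: e i).
Proof.
move=> c0 cj; apply/gen_supportP; exists (c j)^-1; first by rewrite invr_ge0 ltW.
rewrite (bigD1 j) //= scalerDr scalerA mulVf ?gt_eqF // scale1r addrAC subrr add0r.
apply: coneZ => //; first by rewrite invr_ge0 ltW.
by apply: cone_sum => // i _; exact: coneZ.
Qed.

Lemma dominated_gen_sum S j : j \in S -> dominated K (e j) (gen_sum S).
Proof.
move=> jS; apply: dominatedB; rewrite /gen_sum (bigD1 j) //= addrAC subrr add0r.
exact: cone_sum.
Qed.

Lemma dominated_gen_support y : K y -> dominated K y (gen_sum (gen_support y)).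
Proof.
move=> Ky; have [c c0 Ey] := genK Ky; rewrite {1}Ey.
apply: dominated_sum => // j _; have := c0 j; rewrite le_eqVlt => /predU1P[<-|cj].
  by rewrite scale0r; exact: dominated0.
apply: dominatedZ => //; apply: dominated_gen_sum.
by rewrite Ey; exact: gen_support_sum.
Qed.

Lemma gen_sum_dominated S y : S \subset gen_support y -> dominated K (gen_sum S) y.
Proof.
move=> /fintype.subsetP Sy; apply: dominated_sum => // j jS.
by apply/gen_supportP; exact: Sy.
Qed.

(** * The map on supports induced by a cone-preserving matrix *)

Section Preserving.
Variable A : 'M[R]_n.
Hypothesis KA : cone_preserving K A.

Definition support_image S := gen_support (A *m gen_sum S).

Lemma support_imageS S U : S \subset U -> support_image S \subset support_image U.
Proof.
move=> /fintype.subsetP SU; apply: gen_support_dominated; apply: dominated_mulmx => //.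
by apply: dominated_sum => // j jS; exact/dominated_gen_sum/SU.
Qed.

(** A vector of [K] and the sum of the generators in its support dominate each other, and [A]
    preserves domination. *)
Lemma gen_support_mulmx y : K y -> gen_support (A *m y) = support_image (gen_support y).
Proof.
move=> Ky; apply/eqP; rewrite finset.eqEsubset /support_image.
rewrite !gen_support_dominated //; apply: dominated_mulmx => //.
  exact: gen_sum_dominated.
exact: dominated_gen_support.
Qed.

Lemma cone_expmx k y : K y -> K (A ^+ k *m y).
Proof.
move=> Ky; elim: k => [|k IH]; first by rewrite expr0 mul1mx.
by rewrite exprS -mulmxA; exact: KA.
Qed.

Lemma gen_support_expmx k y : K y ->
  gen_support (A ^+ k *m y) = iter k support_image (gen_support y).
Proof.
move=> Ky; elim: k => [|k IH]; first by rewrite expr0 mul1mx.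
by rewrite exprS -mulmxA gen_support_mulmx ?IH //; exact: cone_expmx.
Qed.

End Preserving.

(** * Extreme generators and the upper bound on the exponent *)

Hypothesis pointedK : pointed K.
Hypothesis ee : forall j, extreme_vector K (e j).
Hypothesis e_inj : forall i j, ray (e i) = ray (e j) -> i = j.

Lemma gen_support_extreme j : gen_support (e j) = [set j]%SET.
Proof.
apply/finset.setP => i; rewrite finset.in_set1; apply/gen_supportP/eqP; last first.
  by move=> ->; exact: dominated_refl.
have [_ ei0 _] := ee i; have [_ _ exj] := ee j.
move=> [c]; rewrite le_eqVlt => /predU1P[<-|c0].
  by rewrite scale0r sub0r => /(pointedN pointedK (Ke i))/eqP; rewrite (negPf ei0).
move=> Kc; have c'0 : 0 < c^-1 by rewrite invr_gt0.
have [||a a0 eij] := exj (c^-1 *: e i).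
- by apply: coneZ => //; exact: ltW.
- have -> : e j - c^-1 *: e i = c^-1 *: (c *: e j - e i).
    by rewrite scalerBr scalerA mulVf ?gt_eqF // scale1r.
  by apply: coneZ => //; exact: ltW.
have eiE : e i = (c * a) *: e j.
  by rewrite -scalerA -eij scalerA mulfV ?gt_eqF // scale1r.
have ca0 : 0 < c * a.
  rewrite lt_neqAle mulr_ge0 ?(ltW c0) // andbT eq_sym.
  by apply/eqP => ca; move: ei0; rewrite eiE ca scale0r eqxx.
by apply: e_inj; rewrite eiE rayZ.
Qed.

Lemma gen_support0 : gen_support 0 = finset.set0.
Proof.
apply/eqP; rewrite -finset.subset0; apply/fintype.subsetP => j /gen_supportP[c _].
have [Kj /eqP ej0 _] := ee j.
by rewrite scaler0 sub0r => /(pointedN pointedK Kj).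
Qed.

Lemma nonzero_dominates x : K x -> x != 0 -> exists j, dominated K (e j) x.
Proof.
move=> Kx x0; have [c c0 Ex] := genK Kx.
have [j cj] : exists j, c j != 0.
  apply: contrapT => h; move/eqP: x0; apply; rewrite Ex big1 // => j _.
  by have [->|cj] := eqVneq (c j) 0; rewrite ?scale0r //; case: h; exists j.
exists j; apply/gen_supportP; rewrite Ex; apply: gen_support_sum => //.
by rewrite lt_neqAle eq_sym cj c0.
Qed.

Hypothesis m_gt1 : (1 < m)%N.

Lemma primitive_wielandt A : K_primitive K A ->
  primitive_powers K A (m ^ 2 - 2 * m + 2)%N.
Proof.
move=> [KA [p [p0 pP]]].
have iterE k j : iter k (support_image A) [set j]%SET = gen_support (A ^+ k *m e j).
  by rewrite gen_support_expmx // gen_support_extreme.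
have fullp j : iter p (support_image A) [set j]%SET = [set: 'I_m]%SET.
  rewrite iterE; apply/span_interiorE; first exact: cone_expmx.
  by have [_ ej0 _] := ee j; exact: pP.
have NS := support_imageS KA.
(* The full set is the image of the [(p - 1)]-st iterate of a singleton, hence is contained in the
   image of the full set. *)
have NT : support_image A [set: 'I_m]%SET = [set: 'I_m]%SET.
  apply/eqP; rewrite -finset.subTset -{1}(fullp (Ordinal (ltnW m_gt1))).
  by case: (p) p0 => // q _; apply: NS; exact: finset.subsetT.
have N0 : support_image A finset.set0 = finset.set0.
  by rewrite /support_image /gen_sum finset.big_set0 mulmx0 gen_support0.
have fullM j : iter (m ^ 2 - 2 * m + 2) (support_image A) [set j]%SET = [set: 'I_m]%SET.
  have := @monotone_wielandt _ _ NS NT (fun i => ex_intro _ p (fullp i)) N0 _ j.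
  by rewrite card_ord; apply.
split; first by rewrite addn2.
move=> x Kx x0; apply/span_interiorE; first exact: cone_expmx.
(* Since [x] dominates some generator, its image has at least the support of the image of that
   generator. *)
have [j jx] := nonzero_dominates Kx x0.
apply/eqP; rewrite -finset.subTset -(fullM j) iterE gen_support_dominated //.
by apply: dominated_mulmx jx => z; exact: cone_expmx.
Qed.

Lemma exponent_le A g : K_primitive K A -> matrix_exponent K A g ->
  (g <= m ^ 2 - 2 * m + 2)%N.
Proof. by move=> /primitive_wielandt AP [_]; apply. Qed.

End GeneratedCone.

(** * Existence of primitive matrices *)

Section PositiveFunctional.
Variables (R : realType) (n m : nat) (e : 'I_m -> 'cV[R]_n).
Hypothesis e_pos : forall l : 'I_m -> R,
  (forall j, 0 <= l j) -> \sum_j l j *: e j = 0 -> forall j, l j = 0.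
Hypothesis m_gt0 : (0 < m)%N.

Let dot (x y : 'cV[R]_n) : R := \sum_i x i 0 * y i 0.

Lemma dotDr x y z : dot x (y + z) = dot x y + dot x z.
Proof. by rewrite -big_split; apply: eq_bigr => i _; rewrite mxE mulrDr. Qed.

Lemma dotZr (a : R) x y : dot x (a *: y) = a * dot x y.
Proof. by rewrite mulr_sumr; apply: eq_bigr => i _; rewrite mxE mulrCA. Qed.

Lemma dotC x y : dot x y = dot y x.
Proof. by apply: eq_bigr => i _; rewrite mulrC. Qed.

Lemma dot_gt0 x : x != 0 -> 0 < dot x x.
Proof.
move=> /cV_neq0[i xi].
rewrite /dot (bigD1 i) //= ltr_pwDl //.
  by rewrite -expr2 lt_neqAle sqr_ge0 eq_sym sqrf_eq0 xi.
by apply: sumr_ge0 => j _; rewrite -expr2 sqr_ge0.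
Qed.

Let comb (l : 'rV[R]_m) := \sum_j l 0 j *: e j.

Let simplex := [set l : 'rV[R]_m | (forall j, 0 <= l 0 j) /\ \sum_j l 0 j = 1].

Lemma continuous_sum_real (I : Type) (r : seq I) (T : topologicalType)
    (F : I -> T -> R) :
  (forall i, continuous (F i)) -> continuous (fun x => \sum_(i <- r) F i x).
Proof. by move=> cF; apply: continuous_big => //; exact: add_continuous. Qed.

Lemma compact_simplex : compact simplex.
Proof.
have box : compact [set l : 'rV[R]_m | forall j, `[0, 1]%classic (l ord0 j)].
  by apply: (@rV_compact R m (fun=> `[0, 1]%classic)) => j; exact: segment_compact.
apply: subclosed_compact box _; last first.
  move=> l [l0 l1] j /=; rewrite in_itv /= l0 /= -l1 (bigD1 j) //= lerDl.
  exact: sumr_ge0.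
have -> : simplex = (\bigcap_j (fun l : 'rV[R]_m => l 0 j) @^-1` [set x | 0 <= x])
    `&` (fun l : 'rV[R]_m => \sum_j l 0 j) @^-1` [set x | x = 1].
  by apply/seteqP; split=> l [l0 l1]; split=> // j; [move=> _|]; exact: l0.
apply: closedI.
  apply: closed_bigI => j _; apply: preimage_closed; last exact: closed_ge.
  by move=> l _; exact: coord_continuous.
apply: preimage_closed; last exact: closed_eq.
by move=> l _; apply: continuous_sum_real => j; exact: coord_continuous.
Qed.

(* The point of least Euclidean norm in the convex hull of the [e j] is the
   normal of a hyperplane strictly separating the hull from the origin. *)
Lemma positive_functional : exists w : 'cV[R]_n, forall j, 0 < (w^T *m e j) 0 0.
Proof.
have dotE x y : (x^T *m y) 0 0 = dot x y.
  by rewrite mxE; apply: eq_bigr => i _; rewrite mxE.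
have combE l i : comb l i 0 = \sum_j l 0 j * e j i 0.
  by rewrite summxE; apply: eq_bigr => j _; rewrite mxE.
have cf : continuous (fun l => dot (comb l) (comb l)).
  apply: continuous_sum_real => i l; under eq_fun do rewrite combE.
  have cc : continuous (fun l : 'rV[R]_m => \sum_j l 0 j * e j i 0).
    apply: continuous_sum_real => j {}l.
    by apply: continuousM; [exact: coord_continuous | exact: cst_continuous].
  by apply: continuousM; exact: cc.
have delta_simplex j : simplex (delta_mx 0 j).
  split=> [i|]; first by rewrite mxE /=; case: eqP.
  by rewrite (bigD1 j) //= mxE !eqxx big1 ?addr0 // => i ij; rewrite mxE (negPf ij).
have ne : simplex !=set0 by exists (delta_mx 0 (Ordinal m_gt0)).
have [l ls lmin] := EVT_min_rV ne compact_simplex (continuous_subspaceT cf).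
have [l0 l1] := set_mem ls.
exists (comb l) => j; rewrite dotE; set w := comb l.
have w0 : w != 0.
  apply/eqP => /(e_pos l0) l00; move/eqP: l1.
  by rewrite big1 // eq_sym oner_eq0.
have ww := dot_gt0 w0; rewrite ltNge; apply/negP => wj.
set d := e j - w.
have dd : 0 <= dot d d by apply: sumr_ge0 => i _; rewrite -expr2 sqr_ge0.
have wd : dot w d = dot w (e j) - dot w w by rewrite dotDr -scaleN1r dotZr mulN1r.
(* From [wj], [dot w d <= - dot w w]. With [t * dot d d <= dot w w], the squared norm of
   [w + t *: d] is below that of [w] by at least [t * dot w w]. *)
pose t := dot w w / (dot w w + dot d d).
have s0 : 0 < dot w w + dot d d by lra.
have t0 : 0 < t by rewrite divr_gt0.
have t1 : t <= 1 by rewrite ler_pdivrMr // mul1r; lra.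
have td : t * dot d d <= dot w w.
  by rewrite /t mulrAC ler_pdivrMr // ler_wpM2l ?(ltW ww) // lerDr ltW.
move: t t0 t1 td => t t0 t1 td.
pose lt := (1 - t) *: l + t *: delta_mx 0 j.
have lts : simplex lt.
  have [dj0 dj1] := delta_simplex j.
  split=> [i|].
    by rewrite mxE mxE [X in _ + X]mxE addr_ge0 // mulr_ge0 ?subr_ge0 // ltW.
  under eq_bigr do rewrite mxE mxE [X in _ + X]mxE.
  by rewrite big_split /= -!mulr_sumr l1 dj1 !mulr1 subrK.
have comb_lt : comb lt = w + t *: d.
  have -> : comb lt = (1 - t) *: w + t *: e j.
    rewrite /comb /w.
    under eq_bigr do rewrite mxE mxE [X in _ + X]mxE scalerDl -!scalerA.
    rewrite big_split /= -!scaler_sumr; congr (_ + _ *: _).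
    rewrite (bigD1 j) //= mxE !eqxx scale1r big1 ?addr0 // => i ij.
    by rewrite mxE (negPf ij) andbF scale0r.
  by rewrite scalerBl scale1r /d scalerBr addrAC addrA.
have := lmin lt (mem_set lts); rewrite comb_lt -/w.
rewrite dotDr dotZr !(dotC (w + _)) !dotDr !dotZr (dotC d w) wd => h.
have : t * (dot w (e j) - dot w w) + t * (dot w (e j) - dot w w + t * dot d d) < 0.
  rewrite -mulrDr pmulr_rlt0 //; lra.
lra.
Qed.

End PositiveFunctional.

(** * Polyhedral cones: generators, exponent bound and a primitive matrix *)

Section PolyhedralCone.
Variables (R : realType) (n m : nat) (K : set 'cV[R]_n).

Lemma extreme_representatives : (extreme_rays K #= `I_m)%card ->
  exists e : 'I_m -> 'cV[R]_n,
    [/\ forall j, extreme_vector K (e j),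
        forall i j, ray (e i) = ray (e j) -> i = j &
        forall x, extreme_vector K x -> exists j, ray (e j) = ray x].
Proof.
rewrite card_eq_sym => /card_set_bijP[f [fK finj fsurj]].
have /choice[e eP] (j : 'I_m) : exists x, extreme_vector K x /\ f j = ray x.
  by have [x] := fK j (ltn_ord j); exists x.
exists e; split=> [j|i j eij|x ex].
- by case: (eP j).
- apply/val_inj/finj; rewrite ?inE; [exact: ltn_ord..|].
  by have [[_ ->] [_ ->]] := (eP i, eP j).
have [|j jm fj] := fsurj (ray x); first by exists x.
by exists (Ordinal jm); rewrite -fj; case: (eP (Ordinal jm)).
Qed.

Hypothesis polyK : polyhedral_cone K.
Hypothesis cardK : (extreme_rays K #= `I_m)%card.

Lemma polyhedral_generators : exists e : 'I_m -> 'cV[R]_n,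
  [/\ forall j, extreme_vector K (e j),
      forall i j, ray (e i) = ray (e j) -> i = j &
      forall x, K x -> exists2 c : 'I_m -> R,
        (forall j, 0 <= c j) & x = \sum_j c j *: e j].
Proof.
have [[closedK pointedK coneK _] _] := polyK.
have [e [ee einj eall]] := extreme_representatives cardK.
exists e; split=> // x /(cone_extreme_sum coneK closedK pointedK)[s es ->].
elim: s es => [|y s IH] es.
  exists (fun=> 0) => //; rewrite big_nil big1 // => j _; exact: scale0r.
have [|c c0 Es] := IH; first by move=> z zs; apply: es; rewrite inE zs orbT.
have [j ej] := eall y (es y (mem_head _ _)).
have [a a0 ya] : ray (e j) y by rewrite ej; exists 1; rewrite ?scale1r.
exists (fun i => c i + a * (i == j)%:R) => [i|].
  by rewrite addr_ge0 // mulr_ge0.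
rewrite big_cons Es addrC; under [RHS]eq_bigr do rewrite scalerDl.
rewrite big_split /= ya; congr (_ + _).
rewrite (bigD1 j) //= eqxx mulr1 big1 ?addr0 // => i /negPf ->.
by rewrite mulr0 scale0r.
Qed.

Hypothesis m_gt1 : (1 < m)%N.

Lemma exponent_le_wielandt A g : K_primitive K A -> matrix_exponent K A g ->
  (g <= m ^ 2 - 2 * m + 2)%N.
Proof.
have [[closedK pointedK coneK _] _] := polyK.
have [e [ee einj genK]] := polyhedral_generators.
by apply: (exponent_le coneK _ genK pointedK ee einj m_gt1) => j; case: (ee j).
Qed.

(** A rank-one matrix does it: with [u] the sum of the generators, an interior vector, and [w] a
    functional positive on them, [u *m w^T] sends each nonzero vector of [K] to a positive multiple
    of [u]. *)
Lemma K_primitive_exists : exists A, K_primitive K A.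
Proof.
have [[closedK pointedK coneK _] _] := polyK.
have [e [ee einj genK]] := polyhedral_generators.
have Ke j : K (e j) by case: (ee j).
have e_pos (l : 'I_m -> R) :
  (forall j, 0 <= l j) -> \sum_j l j *: e j = 0 -> forall j, l j = 0.
  move=> l0 Es j; apply/eqP/negPn/negP => lj.
  have ljgt : 0 < l j by rewrite lt_neqAle eq_sym lj l0.
  have := gen_support_sum coneK Ke l0 ljgt.
  by rewrite Es (gen_support0 pointedK ee) finset.in_set0.
have [w we] := positive_functional e_pos (ltnW m_gt1).
pose u := \sum_j e j; have Ku : K u by exact: cone_sum.
pose phi (x : 'cV[R]_n) := (w^T *m x) 0 0.
have uwE x : (u *m w^T) *m x = phi x *: u.
  by rewrite -mulmxA [w^T *m x]mx11_scalar mul_mx_scalar.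
have phiE c : phi (\sum_j c j *: e j) = \sum_j c j * phi (e j).
  rewrite /phi mulmx_sumr summxE; apply: eq_bigr => j _.
  by rewrite -scalemxAr mxE.
have phi_ge0 x : K x -> 0 <= phi x.
  move=> /genK[c c0 ->]; rewrite phiE; apply: sumr_ge0 => j _.
  by rewrite mulr_ge0 // ltW // we.
exists (u *m w^T); split=> [x Kx|].
  by rewrite uwE; apply: coneZ => //; exact: phi_ge0.
exists 1%N; split=> // x Kx x0; rewrite expr1 uwE.
have phix : 0 < phi x.
  rewrite lt_neqAle phi_ge0 // andbT eq_sym; apply/eqP => phix0.
  have [c c0 Ex] := genK x Kx.
  move: phix0; rewrite Ex phiE => /eqP; rewrite psumr_eq0; last first.
    by move=> j _; rewrite mulr_ge0 // ltW // we.
  move=> /allP h; move/eqP: x0; apply; rewrite Ex big1 // => j _.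
  have := h j (mem_index_enum j); rewrite mulf_eq0 (gt_eqF (we j)) orbF.
  by move=> /eqP ->; rewrite scale0r.
apply: (dominates_span_interior coneK Ke genK); first by apply: coneZ => //; exact: ltW.
move=> j; exists (phi x)^-1; first by rewrite invr_ge0 ltW.
rewrite scalerA mulVf ?gt_eqF // scale1r /u (bigD1 j) //= addrAC subrr add0r.
exact: cone_sum.
Qed.

Lemma cone_exponent_exists : exists g, cone_exponent K g.
Proof.
apply: (@is_max_exists _ (m ^ 2 - 2 * m + 2)).
  have [A pA] := K_primitive_exists; have [_ ne] := pA.
  by have [g Ag] := is_min_exists ne; exists g, A.
by move=> g [A pA Ag]; exact: exponent_le_wielandt Ag.
Qed.

End PolyhedralCone.

(** * The nonnegative orthant and Wielandt's matrix *)

Section Orthant.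
Variables (R : realType) (m : nat).

Definition orthant : set 'cV[R]_m := [set x | forall i, 0 <= x i 0].

Let e (j : 'I_m) : 'cV[R]_m := delta_mx j 0.

Let eE i j : e j i 0 = (i == j)%:R. Proof. by rewrite mxE eqxx andbT. Qed.

Lemma orthant_convex_cone : convex_cone orthant.
Proof.
split=> [i|x y x0 y0 i|a x a0 x0 i]; rewrite mxE //.
  exact: addr_ge0.
exact: mulr_ge0.
Qed.

Lemma orthant_closed : closed orthant.
Proof.
have -> : orthant = \bigcap_i (fun x : 'cV[R]_m => x i 0) @^-1` [set y | 0 <= y].
  by apply/seteqP; split=> x x0 i; [move=> _|]; exact: x0.
apply: closed_bigI => i _; apply: preimage_closed; last exact: closed_ge.
by move=> x _; exact: coord_continuous.
Qed.

Lemma orthant_pointed : pointed orthant.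
Proof.
apply/seteqP; split=> [x [x0 nx0]|_ -> /=]; last first.
  by split=> i; rewrite !mxE ?oppr0.
apply/colP => i; rewrite mxE; apply/eqP; rewrite eq_le x0 andbT -oppr_ge0.
by have := nx0 i; rewrite mxE.
Qed.

Lemma orthant_delta j : orthant (e j).
Proof. by move=> i; rewrite eE; case: eqP. Qed.

Lemma orthant_gen x : orthant x ->
  exists2 c : 'I_m -> R, (forall j, 0 <= c j) & x = \sum_j c j *: e j.
Proof.
move=> x0; exists (fun j => x j 0) => //; apply/colP => i.
rewrite summxE (bigD1 i) //= mxE eE eqxx mulr1 big1 ?addr0 // => j ji.
by rewrite mxE eE eq_sym (negPf ji) mulr0.
Qed.

Lemma orthant_interiorP y : span_interior orthant y <-> forall i, 0 < y i 0.
Proof.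
split=> [iy i|y0].
  have [c c0 /(_ i)] :=
    span_interior_dominates orthant_convex_cone iy (orthant_delta i).
  have yi := span_interior_cone iy i.
  rewrite !mxE !eqxx subr_ge0 => h; rewrite lt0r yi andbT.
  by apply/eqP => yi0; move: h; rewrite yi0 mulr0 ler10.
apply: (dominates_span_interior orthant_convex_cone orthant_delta orthant_gen).
  by move=> i; exact: ltW.
move=> j; exists (y j 0)^-1; first by rewrite invr_ge0 ltW.
move=> i; rewrite !mxE eqxx andbT subr_ge0; case: eqP => [->|_].
  by rewrite mulVf // gt_eqF.
by rewrite mulr_ge0 // ?invr_ge0 ltW.
Qed.

Lemma ray_delta_inj i j : ray (e i) = ray (e j) -> i = j.
Proof.
move=> eij; have [a _ /colP/(_ i)] : ray (e j) (e i).
  by rewrite -eij; exists 1; rewrite ?scale1r.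
rewrite [RHS]mxE !eE eqxx; case: eqP => // _ /eqP.
by rewrite mulr0 oner_eq0.
Qed.

(** An extreme [x] with [x j 0 != 0] lies above [x j 0 *: e j], which must then span its ray;
    conversely a vector of the orthant below [e j] vanishes off [j]. *)
Lemma orthant_extreme_rays :
  extreme_rays orthant = [set ray (e j) | j in [set: 'I_m]].
Proof.
apply/seteqP; split=> [_ [x [Kx x0 ex] ->]|_ [j _ <-]].
  have [j xj] := cV_neq0 x0.
  have xj0 : 0 < x j 0 by rewrite lt_neqAle eq_sym xj Kx.
  have [||a a0 xja] := ex (x j 0 *: e j).
  - by apply: (coneZ orthant_convex_cone) => //; exact: orthant_delta.
  - move=> i; rewrite !mxE eqxx andbT subr_ge0; case: eqP => [->|_].
      by rewrite mulr1.
    by rewrite mulr0; exact: Kx.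
  exists j => //; rewrite -(rayZ (e j) xj0) xja rayZ // lt_neqAle a0 andbT eq_sym.
  apply/eqP => a00; move/colP/(_ j): xja; rewrite a00 !mxE !eqxx mul0r mulr1 => xj00.
  by rewrite xj00 eqxx in xj.
exists (e j) => //; split; first exact: orthant_delta.
  apply/eqP => /colP/(_ j)/eqP; rewrite eE eqxx mxE oner_eq0.
  by [].
move=> y y0 yj; exists (y j 0); first exact: y0.
apply/colP => i; rewrite mxE eE; case: eqP => [->|/eqP ij]; first by rewrite mulr1.
rewrite mulr0; apply/eqP; rewrite eq_le y0 andbT.
by have := yj i; rewrite mxE eE (negPf ij) mxE add0r oppr_ge0.
Qed.

Lemma orthant_card_extreme_rays : (extreme_rays orthant #= `I_m)%card.
Proof.
rewrite orthant_extreme_rays; apply: (@card_eq_trans _ _ _ _ [set: 'I_m]).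
  by apply: inj_card_eq => i j _ _; exact: ray_delta_inj.
by rewrite card_eq_sym; exact: card_II.
Qed.

Lemma orthant_polyhedral : polyhedral_cone orthant.
Proof.
split; last by exists m; exact: orthant_card_extreme_rays.
split; [exact: orthant_closed | exact: orthant_pointed | exact: orthant_convex_cone |].
by exists (const_mx 1); apply/orthant_interiorP => i; rewrite mxE ltr01.
Qed.

Variable A : 'M[R]_m.
Hypothesis A_ge0 : forall i j, 0 <= A i j.

Lemma orthant_preserving : cone_preserving orthant A.
Proof. by move=> x x0 i; rewrite mxE; apply: sumr_ge0 => j _; exact: mulr_ge0. Qed.

Lemma expmx_ge0 k i j : 0 <= (A ^+ k) i j.
Proof.
elim: k i j => [|k IH] i j; first by rewrite expr0 mxE; case: eqP.
by rewrite exprS mxE; apply: sumr_ge0 => l _; exact: mulr_ge0.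
Qed.

(** Concatenation of walks at [h]: a positive [(i, j)] entry of [A ^+ k] is a walk of length [k]
    from [j] to [i]. *)
Lemma expmxD_gt0 k l i j h :
  0 < (A ^+ k) i h -> 0 < (A ^+ l) h j -> 0 < (A ^+ (k + l)) i j.
Proof.
move=> ih hj; rewrite exprD mxE (bigD1 h) //= ltr_pwDl ?mulr_gt0 //.
by apply: sumr_ge0 => g _; apply: mulr_ge0; exact: expmx_ge0.
Qed.

Lemma orthant_primitive_powersP p :
  primitive_powers orthant A p <-> (0 < p)%N /\ forall i j, 0 < (A ^+ p) i j.
Proof.
split=> -[p0 Ap]; split=> //.
  move=> i j; have ej0 : e j != 0.
    by apply/eqP => /colP/(_ j)/eqP; rewrite eE eqxx mxE oner_eq0.
  have /orthant_interiorP/(_ i) := Ap _ (orthant_delta j) ej0.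
  by rewrite /e -colE mxE.
move=> x Kx x0; apply/orthant_interiorP => i.
have [j xj] := cV_neq0 x0.
rewrite mxE (bigD1 j) //= ltr_pwDl //.
  by rewrite mulr_gt0 // lt_neqAle eq_sym xj Kx.
by apply: sumr_ge0 => h _; rewrite mulr_ge0 // ltW.
Qed.

End Orthant.

(** * Walks in the graph of Wielandt's matrix *)

Section Wielandt.
Variables (R : realType) (m : nat).
Hypothesis m_ge3 : (3 <= m)%N.

(* Column [j] lists the successors of vertex [j]: the cycle
   [0 -> 1 -> .. -> m-1 -> 0] together with the chord [m-1 -> 1]. *)
Definition wielandt_mx : 'M[R]_m :=
  \matrix_(i, j) ((i == j.+1 :> nat) || (j == m.-1 :> nat) && (i <= 1)%N)%:R.

Local Notation W := wielandt_mx.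

Lemma wielandt_ge0 i j : 0 <= W i j.
Proof. by rewrite mxE ler0n. Qed.

Lemma wielandt_gt0 (i j : 'I_m) :
  (i == j.+1 :> nat) || (j == m.-1 :> nat) && (i <= 1)%N -> 0 < (W ^+ 1) i j.
Proof. by rewrite expr1 mxE => ->; exact: ltr01. Qed.

Lemma wielandt_path k (i j : 'I_m) : i = (j + k)%N :> nat -> 0 < (W ^+ k) i j.
Proof.
elim: k i => [|k IH] i ijk.
  have -> : i = j by apply: val_inj; rewrite /= ijk addn0.
  by rewrite expr0 mxE eqxx ltr01.
have km : (j + k < m)%N by have := ltn_ord i; lia.
rewrite -add1n; apply: (expmxD_gt0 wielandt_ge0 (h := Ordinal km)).
  by apply: wielandt_gt0; rewrite /= ijk addnS eqxx.
exact: IH.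
Qed.

Let v0 : 'I_m := Ordinal (ltnW (ltnW m_ge3)).
Let v1 : 'I_m := Ordinal (ltnW m_ge3).
Let last_lt : (m.-1 < m)%N. Proof. by case: m m_ge3. Qed.
Let vl : 'I_m := Ordinal last_lt.

Let walkD := expmxD_gt0 wielandt_ge0.

(** Vertex [1] lies on the full cycle of length [m] and, through the chord, on a cycle of length
    [m - 1]. *)
Lemma wielandt_cycles a b : 0 < (W ^+ (m * a + m.-1 * b)) v1 v1.
Proof.
have l1 : 0 < (W ^+ m.-2) vl v1 by apply: wielandt_path => /=; lia.
have step1 : 0 < (W ^+ 1) v1 vl by apply: wielandt_gt0; rewrite /= eqxx ?orbT.
have step0 : 0 < (W ^+ 1) v0 vl by apply: wielandt_gt0; rewrite /= eqxx ?orbT.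
have step01 : 0 < (W ^+ 1) v1 v0 by apply: wielandt_gt0.
have short : 0 < (W ^+ m.-1) v1 v1.
  have -> : m.-1 = (1 + m.-2)%N by lia.
  exact: walkD step1 l1.
have long : 0 < (W ^+ m) v1 v1.
  have mE : (1 + (1 + m.-2))%N = m by lia.
  by have := walkD step01 (walkD step0 l1); rewrite [in X in X -> _]mE.
have rep k c : 0 < (W ^+ k) v1 v1 -> 0 < (W ^+ (k * c)) v1 v1.
  move=> kv; elim: c => [|c IH]; first by rewrite muln0 expr0 mxE eqxx ltr01.
  by rewrite mulnS; exact: walkD kv IH.
by apply: walkD; exact: rep.
Qed.

(** A generous power, meant only for primitivity: walk from [j] to vertex [1] and from [1] to [i] in
    at most [m] steps each, and spend the remaining time on closed walks at [1]. *)
Lemma wielandt_primitive : primitive_powers (@orthant R m) W (m * m.+1)%N.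
Proof.
apply/orthant_primitive_powersP; split; first by lia.
move=> i j.
have [s sm sj] : exists2 s, (s <= m)%N & 0 < (W ^+ s) v1 j.
  have [j0|j0] := posnP j.
    exists 1%N; first by lia.
    by apply: wielandt_gt0; rewrite /= j0.
  exists (1 + (m.-1 - j))%N; first by lia.
  apply: (walkD (h := vl)); first by apply: wielandt_gt0; rewrite /= eqxx ?orbT.
  by apply: wielandt_path => /=; have := ltn_ord j; lia.
have [t tm ti] : exists2 t, (t <= m)%N & 0 < (W ^+ t) i v1.
  have [i0|i0] := posnP i.
    exists (1 + m.-2)%N; first by lia.
    apply: (walkD (h := vl)); last by apply: wielandt_path => /=; lia.
    by apply: wielandt_gt0; rewrite /= eqxx i0 orbT.
  exists i.-1; first by have := ltn_ord i; lia.
  by apply: wielandt_path => /=; lia.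
pose k := (m * m.+1 - s - t)%N.
have kE : (m * m.+1)%N = (t + (k + s))%N by rewrite /k; nia.
have km : (m.-1 * m <= k)%N by rewrite /k; nia.
have m1 : (0 < m.-1)%N by lia.
have qm : (m <= k %/ m.-1)%N by rewrite leq_divRL // mulnC.
have rm : (k %% m.-1 < m.-1)%N by rewrite ltn_mod.
(* With [k = q (m - 1) + r], [r < m - 1] and [q >= m], trade [r] of the short cycles and the
   remainder for [r] long ones. *)
have kab : k = (m * (k %% m.-1) + m.-1 * (k %/ m.-1 - k %% m.-1))%N.
  rewrite [LHS](divn_eq k m.-1) mulnBr mulnC; nia.
rewrite kE; apply: walkD ti _; apply: walkD sj.
by rewrite kab; exact: wielandt_cycles.
Qed.

(* A walk from [0] makes [a] turns through the edge [m-1 -> 0] and [b] turns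
   through the chord [m-1 -> 1]. *)
Lemma wielandt_walk_length k (i : 'I_m) : (W ^+ k) i v0 != 0 ->
  exists a b, k = (i + m * a + m.-1 * b)%N /\ (i = 0%N :> nat -> k = 0%N \/ (0 < a)%N).
Proof.
elim: k i => [|k IH] i.
  rewrite expr0 mxE; have [-> _|] := eqVneq i v0; last by rewrite eqxx.
  by exists 0%N, 0%N; rewrite !muln0; split=> //; left.
rewrite exprS mxE => h.
have [j] : exists j, W i j * (W ^+ k) j v0 != 0.
  apply: contrapT => nj; move/eqP: h; apply; apply: big1 => j _.
  by apply/eqP/negPn/negP => hj; apply: nj; exists j.
rewrite mulf_eq0 negb_or => /andP[Wij /IH[a [b [kE ka]]]].
(* The last edge climbs to a nonzero vertex, or leaves [m - 1] for [0], raising [a], or for [1],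
   raising [b]. *)
move: Wij; rewrite mxE pnatr_eq0 eqb0 negbK => /orP[/eqP ij|/andP[/eqP jl i1]].
  by exists a, b; split; [rewrite kE; lia | rewrite ij].
have [i0|i0] := posnP i.
  by exists a.+1, b; split; [rewrite kE jl i0; nia | right].
exists a, b.+1; split; last by move=> i00; rewrite i00 in i0.
have -> : i = 1%N :> nat by lia.
by rewrite kE jl; nia.
Qed.

(** No closed walk at [0] has length [(m - 1)^2], one less than the bound, whereas positivity of a
    power passes to all later powers. *)
Lemma wielandt_exponent_ge p : primitive_powers (@orthant R m) W p ->
  (m ^ 2 - 2 * m + 2 <= p)%N.
Proof.
move=> /orthant_primitive_powersP[_ Wp].
rewrite leqNgt; apply/negP => pm.
(* Every vertex has a successor, so a walk can be prolonged at its start. *)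
have full k : forall i j, 0 < (W ^+ (p + k)) i j.
  elim: k => [|k IH] i j; first by rewrite addn0.
  have [h hj] : exists h, 0 < (W ^+ 1) h j.
    have [j1|j1] := ltnP j.+1 m.
      by exists (Ordinal j1); apply: wielandt_gt0; rewrite /= eqxx.
    exists v1; apply: wielandt_gt0; rewrite /= andbT orbC.
    by apply/orP; left; have := ltn_ord j; lia.
  by rewrite addnS -addn1; exact: walkD (IH i h) hj.
have : (W ^+ (m.-1 ^ 2)) v0 v0 != 0.
  have -> : (m.-1 ^ 2 = p + (m.-1 ^ 2 - p))%N by nia.
  by rewrite gt_eqF.
move=> /wielandt_walk_length[a [b [/= E]]]; case=> // [|a0]; first by nia.
(* Modulo [m - 1], the length equation makes [a] a multiple of [m - 1]; being positive, it gives
   [m * a >= m * (m - 1)], which exceeds [(m - 1)^2]. *)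
have /dvdnP[c ac] : (m.-1 %| a)%N.
  have : (m.-1 %| m.-1 * (a + b) + a)%N.
    have -> : (m.-1 * (a + b) + a = m.-1 * m.-1)%N by nia.
    exact: dvdn_mulr.
  by rewrite dvdn_addr // dvdn_mulr.
have : (0 < c)%N by lia.
nia.
Qed.

Lemma orthant_cone_exponent : cone_exponent (@orthant R m) (m ^ 2 - 2 * m + 2)%N.
Proof.
have polyK := @orthant_polyhedral R m.
have cardK := @orthant_card_extreme_rays R m.
have m_gt1 : (1 < m)%N by exact: ltnW.
have Wprim : K_primitive (@orthant R m) W.
  split; first exact: orthant_preserving wielandt_ge0.
  by exists (m * m.+1)%N; exact: wielandt_primitive.
have [g Wg] : exists g, matrix_exponent (@orthant R m) W g.
  by apply: is_min_exists; case: Wprim.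
have gE : g = (m ^ 2 - 2 * m + 2)%N.
  apply/eqP; rewrite eqn_leq (exponent_le_wielandt polyK cardK m_gt1 Wprim Wg).
  by case: Wg => /wielandt_exponent_ge.
split; first by exists W; rewrite // -gE.
by move=> k [A pA Ak]; exact: exponent_le_wielandt pA Ak.
Qed.

End Wielandt.

(** The first conjunct makes the exponent of every such cone well defined, so that the maximum in
    the second one ranges over all of them. *)
Theorem corollary4p10 (R : realType) (m : nat) (hm : (3 <= m)%N) :
  (forall (n : nat) (K : set 'cV[R]_n),
     polyhedral_cone K -> (extreme_rays K #= `I_m)%card ->
     exists g : nat, cone_exponent K g) /\
  is_max
    [set g : nat | exists (n : nat) (K : set 'cV[R]_n),
       [/\ polyhedral_cone K, (extreme_rays K #= `I_m)%card
         & cone_exponent K g]]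
    (m ^ 2 - 2 * m + 2)%N.
Proof.
have m_gt1 : (1 < m)%N by exact: ltnW.
split=> [n K polyK cardK|]; first exact: cone_exponent_exists cardK m_gt1.
split.
  exists m, (@orthant R m); split.
  - exact: orthant_polyhedral.
  - exact: orthant_card_extreme_rays.
  - exact: orthant_cone_exponent.
move=> g [n [K [polyK cardK [[A pA Ag] _]]]].
exact: exponent_le_wielandt pA Ag.
Qed.
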